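(* Let $u, v \ge 1$ be integers. A general binary form $p \in H_{uv}(\mathbb{C}^2)$ can be written as a sum of $\lceil \frac{uv+1}{u+1}\rceil$ $v$-th powers of binary forms of degree $u$. That is, $p = \sum_{i=1}^{N} f_i^v$ with $N = \lceil \frac{uv+1}{u+1}\rceil$ and each $f_i \in H_u(\mathbb{C}^2)$.
   Context: $H_d(\mathbb{C}^n)$ denotes the complex vector space of homogeneous polynomials of degree $d$ in $n$ variables. ''A general $p$ has property P'' means P holds for all $p$ in a nonempty Zariski-open subset of $H_d(\mathbb{C}^n)$. *)

(* Defs.v *)
From HB Require Import structures.
From mathcomp Require Import all_boot all_order all_algebra.
Set Implicit Arguments. Unset Strict Implicit. Unset Printing Implicit Defensive.
Import GRing.Theory.
Local Open Scope ring_scope.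

Inductive mpoly (R : Type) (n : nat) : Type :=
| MVar of 'I_n
| MConst of R
| MAdd of mpoly R n & mpoly R n
| MMul of mpoly R n & mpoly R n.

Fixpoint meval (R : nzRingType) (n : nat) (x : 'I_n -> R) (g : mpoly R n) : R :=
  match g with
  | MVar i => x i
  | MConst c => c
  | MAdd g1 g2 => meval x g1 + meval x g2
  | MMul g1 g2 => meval x g1 * meval x g2
  end.

Definition zariski_open (R : nzRingType) (n : nat) (U : ('I_n -> R) -> Prop) :=
  exists S : mpoly R n -> Prop,
    forall x, U x <-> exists2 g, S g & meval x g != 0.

Definition general (R : nzRingType) (n : nat) (P : ('I_n -> R) -> Prop) :=
  exists U : ('I_n -> R) -> Prop,
    [/\ zariski_open U, (exists x, U x) & forall x, U x -> P x].

(* The binary form of degree d with coefficient vector c, i.e.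
   sum_i c_i x^i y^(d-i), represented by its dehomogenization (y = 1). *)
Definition binform (R : nzRingType) (d : nat) (c : 'I_d.+1 -> R) : {poly R} :=
  \sum_(i < d.+1) c i *: 'X^i.

(* Dehomogenization of a binary form of degree u: a polynomial of size <= u+1. *)
Definition is_binform_deg (R : nzRingType) (u : nat) (f : {poly R}) : bool :=
  (size f <= u.+1)%N.

(* Main.v *)
Require Import Defs.
From HB Require Import structures.
From mathcomp Require Import all_boot all_order all_algebra.
From mathcomp Require Import closed_field.
From Stdlib Require Import Classical.
Local Open Scope ring_scope.
Set Implicit Arguments.
Unset Strict Implicit.
Unset Printing Implicit Defensive.
Import GRing.Theory.

(* At f_i = (X - a_i)^u with distinct a_i, the differential of
   S : (f_i) |-> sum_i f_i^v sends (z_i) to v sum_i (X - a_i)^(uv-u) z_i.  It is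
   onto: if a linear form L kills its image, then the polynomial
   a |-> L((X - a)^(uv)), of degree at most uv, has a zero of order u+1 at each
   of the N points a_i, and N(u+1) > uv, so L = 0.
   By quantifier elimination the image of S is constructible, so it either
   contains a nonempty open set or lies in the zero set of some polynomial
   g <> 0.  In the latter case expand g around S(f): its lowest homogeneous
   part would vanish on the image of the differential, which is everything. *)

(** * Polynomial functions *)

Lemma natr_inj_pchar0 (R : fieldType) :
  [pchar R] =i pred0 -> injective (fun i : nat => i%:R : R).
Proof.
move=> /pcharf0P R0 i j; wlog le_ij : i j / (i <= j)%N => [hw eq_ij|eq_ij].
  by case/orP: (leq_total i j) => le; [|apply/esym]; apply: hw.
apply/eqP; rewrite eqn_leq le_ij -subn_eq0 -R0 natrB // subr_eq0.
exact/eqP.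
Qed.

(** In characteristic zero the elements 0, 1, ..., [size p] - 1 are distinct, too many to be all
    roots of [p]. *)
Lemma poly_nonroot (F : fieldType) (p : {poly F}) :
  [pchar F] =i pred0 -> p != 0 -> exists x, p.[x] != 0.
Proof.
move=> F0 p0; pose rs := [seq i%:R : F | i <- iota 0 (size p)].
have : ~~ all (root p) rs.
  apply/negP => /(max_poly_roots p0); rewrite map_inj_uniq ?iota_uniq;
    last exact: natr_inj_pchar0.
  by move/(_ isT); rewrite size_map size_iota ltnn.
by case/allPn => x _ px; exists x.
Qed.

Lemma poly_eq0_nonzero_values (F : fieldType) (p : {poly F}) :
  [pchar F] =i pred0 -> (forall x, x != 0 -> p.[x] = 0) -> p = 0.
Proof.
move=> F0 p0; apply/eqP/negPn/negP => pn0.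
have : p * 'X != 0 by rewrite mulf_neq0 ?polyX_eq0.
case/(poly_nonroot F0) => x; rewrite hornerM hornerX.
by have [->|/p0->] := eqVneq x 0; rewrite ?mulr0 ?mul0r eqxx.
Qed.

Lemma poly_eq_values (F : fieldType) (p q : {poly F}) :
  [pchar F] =i pred0 -> (forall x, p.[x] = q.[x]) -> p = q.
Proof.
move=> F0 pq; apply/eqP; rewrite -subr_eq0; apply/eqP.
by apply: (poly_eq0_nonzero_values F0) => x _; rewrite hornerD hornerN pq subrr.
Qed.

(** Polynomials are handled through their values: nonzero will mean nonzero at some point, and
    expressions are never compared syntactically. *)
Definition polyfun (R : nzRingType) n (f : ('I_n -> R) -> R) :=
  exists g : mpoly R n, forall x, meval x g = f x.

Lemma eq_polyfun (R : nzRingType) n (f g : ('I_n -> R) -> R) :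
  f =1 g -> polyfun f -> polyfun g.
Proof. by move=> fg [h hE]; exists h => x; rewrite hE. Qed.

Lemma polyfun_eq_arg (R : nzRingType) n (f : ('I_n -> R) -> R) x y :
  polyfun f -> x =1 y -> f x = f y.
Proof.
by case=> g gE xy; rewrite -!gE; elim: g {gE} => //= g1 -> g2 ->.
Qed.

Lemma polyfunX (R : nzRingType) n (i : 'I_n) : polyfun (fun x : 'I_n -> R => x i).
Proof. by exists (MVar R i). Qed.

Lemma polyfunC (R : nzRingType) n (c : R) : polyfun (fun _ : 'I_n -> R => c).
Proof. by exists (MConst n c). Qed.

Lemma polyfunD (R : nzRingType) n (f g : ('I_n -> R) -> R) :
  polyfun f -> polyfun g -> polyfun (fun x => f x + g x).
Proof. by case=> [p pE] [q qE]; exists (MAdd p q) => x /=; rewrite pE qE. Qed.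

Lemma polyfunM (R : nzRingType) n (f g : ('I_n -> R) -> R) :
  polyfun f -> polyfun g -> polyfun (fun x => f x * g x).
Proof. by case=> [p pE] [q qE]; exists (MMul p q) => x /=; rewrite pE qE. Qed.

Lemma polyfunN (R : nzRingType) n (f : ('I_n -> R) -> R) :
  polyfun f -> polyfun (fun x => - f x).
Proof.
move=> pf; apply: (@eq_polyfun _ _ (fun x => -1 * f x)) => [x|].
  by rewrite mulN1r.
exact: polyfunM (polyfunC _ _) pf.
Qed.

Lemma polyfun_sum (R : nzRingType) n I (r : seq I) (f : I -> ('I_n -> R) -> R) :
  (forall i, polyfun (f i)) -> polyfun (fun x => \sum_(i <- r) f i x).
Proof.
move=> pf; elim: r => [|i r IH].
  by apply: eq_polyfun (polyfunC n 0) => x; rewrite big_nil.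
by apply: eq_polyfun (polyfunD (pf i) IH) => x; rewrite big_cons.
Qed.

Definition polyfun_coefs (R : nzRingType) n (f : ('I_n -> R) -> {poly R}) :=
  forall k, polyfun (fun x => (f x)`_k).

Lemma polyfun_coefsC (R : nzRingType) n (p : {poly R}) :
  polyfun_coefs (fun _ : 'I_n -> R => p).
Proof. by move=> k; apply: polyfunC. Qed.

Lemma polyfun_coefsD (R : nzRingType) n (f g : ('I_n -> R) -> {poly R}) :
  polyfun_coefs f -> polyfun_coefs g -> polyfun_coefs (fun x => f x + g x).
Proof.
move=> pf pg k; apply: eq_polyfun (polyfunD (pf k) (pg k)) => x.
by rewrite coefD.
Qed.

Lemma polyfun_coefsM (R : nzRingType) n (f g : ('I_n -> R) -> {poly R}) :
  polyfun_coefs f -> polyfun_coefs g -> polyfun_coefs (fun x => f x * g x).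
Proof.
move=> pf pg k.
apply: (@eq_polyfun _ _ (fun x => \sum_(i < k.+1) (f x)`_i * (g x)`_(k - i))).
  by move=> x; rewrite coefM.
by apply: polyfun_sum => i; apply: polyfunM.
Qed.

Lemma polyfun_coefsXn (R : nzRingType) n (f : ('I_n -> R) -> {poly R}) v :
  polyfun_coefs f -> polyfun_coefs (fun x => f x ^+ v).
Proof.
move=> pf; elim: v => [|v IH]; first exact: polyfun_coefsC.
by move=> k; apply: eq_polyfun (polyfun_coefsM pf IH k) => x; rewrite exprS.
Qed.

Lemma polyfun_coefs_sum (R : nzRingType) n I (r : seq I)
    (f : I -> ('I_n -> R) -> {poly R}) :
  (forall i, polyfun_coefs (f i)) ->
  polyfun_coefs (fun x => \sum_(i <- r) f i x).
Proof.
move=> pf k; apply: eq_polyfun (polyfun_sum r (fun i => pf i k)) => x.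
by rewrite coef_sum.
Qed.

Lemma polyfun_coefsZ (R : nzRingType) n (f : ('I_n -> R) -> R) (p : {poly R}) :
  polyfun f -> polyfun_coefs (fun x => f x *: p).
Proof.
move=> pf k; apply: eq_polyfun (polyfunM pf (polyfunC _ p`_k)) => x.
by rewrite coefZ.
Qed.

(** * Restriction to curves and Taylor expansion *)

Lemma polyfun_curve (R : comNzRingType) n (f : ('I_n -> R) -> R)
    (w : 'I_n -> {poly R}) :
  polyfun f -> exists p : {poly R}, forall t, p.[t] = f (fun j => (w j).[t]).
Proof.
case=> g gE; suff [p pE]: exists p : {poly R}, forall t,
  p.[t] = meval (fun j => (w j).[t]) g by exists p => t; rewrite pE gE.
elim: g {gE} => [i|c|g1 [p1 p1E] g2 [p2 p2E]|g1 [p1 p1E] g2 [p2 p2E]] /=.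
- by exists (w i).
- by exists c%:P => t; rewrite hornerC.
- by exists (p1 + p2) => t; rewrite hornerD p1E p2E.
- by exists (p1 * p2) => t; rewrite hornerM p1E p2E.
Qed.

(** Irreducibility of affine space: on the line through [x] and [y] both functions restrict to
    nonzero univariate polynomials, whose product is nonzero. *)
Lemma polyfun_mul_neq0 (F : fieldType) n (f g : ('I_n -> F) -> F) :
  [pchar F] =i pred0 -> polyfun f -> polyfun g ->
  (exists x, f x != 0) -> (exists x, g x != 0) -> exists x, f x * g x != 0.
Proof.
move=> F0 pf pg [x fx] [y gy].
pose w j := (x j)%:P + (y j - x j) *: 'X.
have [p pE] := polyfun_curve w pf; have [q qE] := polyfun_curve w pg.
have p0 : p != 0.
  apply: contra_neq fx => p0; rewrite -(horner0 0) -p0 pE.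
  by apply: polyfun_eq_arg pf _ => j; rewrite /w !hornerE.
have q0 : q != 0.
  apply: contra_neq gy => q0; rewrite -(horner0 1) -q0 qE.
  by apply: polyfun_eq_arg pg _ => j; rewrite hornerD hornerC hornerZ hornerX
    mulr1 addrC subrK.
have [t] := poly_nonroot F0 (mulf_neq0 p0 q0).
by rewrite hornerM pE qE; exists (fun j => (w j).[t]).
Qed.

(** The coefficient of index k of [T w] is the degree k homogeneous part of [f] at [q], evaluated at
    [w]. The bound [D] is uniform in [w]. *)
Lemma polyfun_taylor (R : comNzRingType) n (f : ('I_n -> R) -> R) (q : 'I_n -> R) :
  polyfun f -> exists D (T : ('I_n -> R) -> {poly R}),
  [/\ polyfun_coefs T, forall w, (size (T w) <= D)%N &
      forall w s, (T w).[s] = f (fun j => q j + s * w j)].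
Proof.
case=> g gE; suff [D [T [cT sT TE]]]: exists D (T : ('I_n -> R) -> {poly R}),
  [/\ polyfun_coefs T, forall w, (size (T w) <= D)%N &
      forall w s, (T w).[s] = meval (fun j => q j + s * w j) g].
  by exists D, T; split=> // w s; rewrite TE gE.
elim: g {gE} => [i|c|g1 [D1 [T1 [c1 s1 E1]]] g2 [D2 [T2 [c2 s2 E2]]]|
                 g1 [D1 [T1 [c1 s1 E1]]] g2 [D2 [T2 [c2 s2 E2]]]] /=.
- exists 2, (fun w => (q i)%:P + w i *: 'X); split=> [|w|w s].
  + apply: polyfun_coefsD; first exact: polyfun_coefsC.
    exact/polyfun_coefsZ/polyfunX.
  + rewrite (leq_trans (size_polyD _ _)) // geq_max.
    rewrite (leq_trans (size_polyC_leq1 _)) //=.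
    by rewrite (leq_trans (size_scale_leq _ _)) // size_polyX.
  + by rewrite !hornerE mulrC.
- exists 1, (fun=> c%:P); split=> [|w|w s]; first exact: polyfun_coefsC.
  + exact: size_polyC_leq1.
  + by rewrite hornerC.
- exists (maxn D1 D2), (fun w => T1 w + T2 w); split=> [|w|w s].
  + exact: polyfun_coefsD.
  + rewrite (leq_trans (size_polyD _ _)) // geq_max !leq_max s1 s2.
    by rewrite orbT.
  + by rewrite hornerD E1 E2.
- exists (D1 + D2)%N, (fun w => T1 w * T2 w); split=> [|w|w s].
  + exact: polyfun_coefsM.
  + rewrite (leq_trans (size_polyMleq _ _)) //.
    by rewrite (leq_trans (leq_pred _)) // leq_add.
  + by rewrite hornerM E1 E2.
Qed.

(* Along q + t w(t), the lowest nonzero coefficient c_k of the Taylor expansion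
   of g at q contributes c_k(w(0)) t^k, and w(0) is arbitrary. *)
Lemma polyfun_curves_eq0 (F : fieldType) n (g : ('I_n -> F) -> F) (q : 'I_n -> F) :
  [pchar F] =i pred0 -> polyfun g ->
  (forall w0 : 'I_n -> F, exists w : 'I_n -> {poly F},
     (forall j, (w j).[0] = w0 j) /\
     forall t, g (fun j => q j + t * (w j).[t]) = 0) ->
  forall x, g x = 0.
Proof.
move=> F0 pg curves x; apply/eqP/negPn/negP => gx.
have [D [T [cT sT TE]]] := polyfun_taylor q pg.
(* In the direction x - q the expansion takes the value g(x) at s = 1. *)
have exk : exists k w, (T w)`_k != 0.
  have : T (fun j => x j - q j) != 0.
    apply: contra_neq gx => T0; rewrite -(horner0 1) -T0 TE.
    by apply: polyfun_eq_arg pg _ => j; rewrite mul1r addrC subrK.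
  by rewrite -lead_coef_eq0 => ?; eexists; eexists; eassumption.
(* The least k whose homogeneous part is not identically zero, with a point [w0] where it is
   nonzero. *)
have [k [[w0 Tk] kmin]] : exists k, (exists w, (T w)`_k != 0) /\
    forall i, (i < k)%N -> forall w, (T w)`_i = 0.
  case: exk => k; elim/ltn_ind: k => k IH Tk.
  case: (classic (exists2 i, (i < k)%N & exists w, (T w)`_i != 0)).
    by case=> i /IH.
  move=> no_i; exists k; split=> // i ik w; apply/eqP/negPn/negP => Ti.
  by case: no_i; exists i => //; exists w.
have [w [w0E gw]] := curves w0.
have [c cE] : exists c : 'I_D -> {poly F}, forall i t,
    (c i).[t] = (T (fun j => (w j).[t]))`_i.
  exact: (fin_all_exists (fun i : 'I_D => polyfun_curve w (cT i))).
have kD : (k < D)%N.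
  rewrite ltnNge; apply: contra Tk => Dk.
  by rewrite nth_default // (leq_trans (sT _)).
(* For t != 0, Q(t) is g(q + t w(t)) / t^k; and Q(0) is the degree k part at [w0]. *)
pose Q : {poly F} := \sum_(i < D | (k <= i)%N) c i * 'X^(i - k).
have QE t : t ^+ k * Q.[t] = 0.
  rewrite -(gw t) -TE (horner_coef_wide _ (sT _))
    (bigID (fun i : 'I_D => k <= i)%N) /=.
  rewrite [X in _ + X]big1 => [|i];
    last by rewrite -ltnNge => /kmin->; rewrite mul0r.
  rewrite addr0 horner_sum mulr_sumr; apply: eq_bigr => i ki.
  by rewrite hornerM hornerXn cE mulrCA -exprD subnKC.
have Q0 : Q = 0.
  apply: (poly_eq0_nonzero_values F0) => t t0.
  by apply/eqP; have /eqP := QE t; rewrite mulf_eq0 expf_eq0 (negPf t0) andbF.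
case/negP: Tk; rewrite -(polyfun_eq_arg (cT k) w0E) -(cE (Ordinal kD)).
apply/eqP; rewrite -[RHS](horner0 0) -Q0 horner_sum (bigD1 (Ordinal kD)) //=.
rewrite subnn expr0 mulr1 big1 ?addr0 // => i /andP[ki ik].
have lt_ki : (k < i)%N by rewrite ltn_neqAle ki andbT eq_sym.
by rewrite hornerM hornerXn expr0n subn_eq0 leqNgt lt_ki mulr0.
Qed.

(** * Images of polynomial maps *)

Definition env (F : fieldType) n (x : 'I_n -> F) : seq F :=
  [seq x i | i <- enum 'I_n].

Lemma size_env (F : fieldType) n (x : 'I_n -> F) : size (env x) = n.
Proof. by rewrite size_map size_enum_ord. Qed.

Lemma nth_env (F : fieldType) n (x : 'I_n -> F) (i : 'I_n) : (env x)`_i = x i.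
Proof. by rewrite (nth_map i) ?size_enum_ord // nth_ord_enum. Qed.

Lemma polyfun_eval_rterm (F : fieldType) n (t : GRing.term F) :
  GRing.rterm t -> polyfun (fun x : 'I_n -> F => GRing.eval (env x) t).
Proof.
elim: t => //=.
- move=> i _; case: (ltnP i n) => [lt_in|le_ni].
    by apply: eq_polyfun (polyfunX _ (Ordinal lt_in)) => x; rewrite -nth_env.
  by apply: eq_polyfun (polyfunC _ 0) => x; rewrite nth_default ?size_env.
- by move=> c _; apply: polyfunC.
- by move=> k _; apply: polyfunC.
- by move=> t1 IH1 t2 IH2 /andP[/IH1 p1 /IH2 p2]; apply: polyfunD.
- by move=> t IH /IH; apply: polyfunN.
- move=> t IH k /IH pt; apply: eq_polyfun (polyfunM pt (polyfunC _ k%:R)) => x.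
  by rewrite mulr_natr.
- by move=> t1 IH1 t2 IH2 /andP[/IH1 p1 /IH2 p2]; apply: polyfunM.
- move=> t IH k /IH pt; elim: k => [|k IHk]; first exact: polyfunC 1.
  by apply: eq_polyfun (polyfunM pt IHk) => x; rewrite exprS.
Qed.

(* A constructible set contains or avoids a nonempty principal open set. *)
Lemma qf_generic (F : fieldType) n (q : GRing.formula F) :
  [pchar F] =i pred0 -> GRing.qf_form q -> GRing.rformula q ->
  exists g : ('I_n -> F) -> F, [/\ polyfun g, exists x, g x != 0 &
    exists b, forall x, g x != 0 -> GRing.qf_eval (env x) q = b].
Proof.
move=> F0; elim: q => //=.
- move=> b _ _; exists (fun=> 1); split; first exact: polyfunC.
    by exists (fun=> 0); apply: oner_neq0.
  by exists b.
- move=> t1 t2 _ /andP[r1 r2].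
  pose g x := GRing.eval (@env F n x) t1 - GRing.eval (env x) t2.
  have pg : polyfun g.
    by apply: polyfunD; [|apply: polyfunN]; apply: polyfun_eval_rterm.
  (* If the terms differ somewhere, the equality is generically false; otherwise it holds
     everywhere. *)
  case: (classic (exists x, g x != 0)) => [gn0|g0].
    exists g; split=> //; exists false => x gx.
    by apply/negbTE; rewrite -subr_eq0.
  exists (fun=> 1); split; first exact: polyfunC.
    by exists (fun=> 0); apply: oner_neq0.
  exists true => x _; rewrite -subr_eq0; apply/negPn/negP => gx.
  by case: g0; exists x.
1-3: move=> q1 IH1 q2 IH2 /andP[/IH1{}IH1 /IH2{}IH2] /andP[].
1-3: move=> /IH1[g1 [p1 n1 [b1 E1]]] /IH2[g2 [p2 n2 [b2 E2]]].
1-3: exists (fun x => g1 x * g2 x); split;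
       [exact: polyfunM | exact: polyfun_mul_neq0 |].
1: exists (b1 && b2). 2: exists (b1 || b2). 3: exists (b1 ==> b2).
1-3: by move=> x; rewrite mulf_eq0 negb_or => /andP[/E1-> /E2->].
move=> q IH qf rf; have [g [pg n0 [b E]]] := IH qf rf.
by exists g; split=> //; exists (~~ b) => x /E->.
Qed.

(** The offset [k] makes room for the target point: in the image formula, variables below [n] hold y
    and the next [m] hold x. *)
Fixpoint term_of_mpoly (F : fieldType) n k (g : mpoly F n) : GRing.term F :=
  match g with
  | MVar i => GRing.Var F (k + i)
  | MConst c => GRing.Const c
  | MAdd g1 g2 => GRing.Add (term_of_mpoly k g1) (term_of_mpoly k g2)
  | MMul g1 g2 => GRing.Mul (term_of_mpoly k g1) (term_of_mpoly k g2)
  end.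

Lemma rterm_term_of_mpoly (F : fieldType) n k (g : mpoly F n) :
  GRing.rterm (term_of_mpoly k g).
Proof. by elim: g => //= g1 -> g2 ->. Qed.

Lemma eval_term_of_mpoly (F : fieldType) n k (g : mpoly F n) e :
  GRing.eval e (term_of_mpoly k g) = meval (fun i : 'I_n => e`_(k + i)) g.
Proof. by elim: g => //= g1 -> g2 ->. Qed.

Lemma holds_foldr_And (F : fieldType) (I : eqType) (s : seq I)
    (f : I -> GRing.formula F) e :
  GRing.holds e (foldr GRing.And (GRing.Bool true) (map f s)) <->
  forall i, i \in s -> GRing.holds e (f i).
Proof.
elim: s => [|i s IH] /=; first by split.
rewrite IH; split=> [[fi fs] j|fs].
  by rewrite inE => /orP[/eqP->|/fs].
by split=> [|j js]; apply: fs; rewrite inE ?eqxx // js orbT.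
Qed.

(** The image is defined by a formula: some x satisfies phi_j(x) = y_j for all j. Over an
    algebraically closed field it has a quantifier-free equivalent, whose generic truth value
    selects the alternative. *)
Lemma polyfun_image_generic (F : closedFieldType) n m
    (phi : 'I_n -> ('I_m -> F) -> F) :
  [pchar F] =i pred0 -> (forall j, polyfun (phi j)) ->
  exists g : ('I_n -> F) -> F, [/\ polyfun g, exists y, g y != 0 &
    (forall y, g y != 0 -> exists x, forall j, phi j x = y j) \/
    (forall x, g (phi^~ x) = 0)].
Proof.
move=> F0 pphi.
have [G GE] := fin_all_exists pphi.
pose eqn (j : 'I_n) := GRing.Equal (GRing.Var F j) (term_of_mpoly n (G j)).
pose f := foldr GRing.Exists
  (foldr GRing.And (GRing.Bool true) (map eqn (enum 'I_n))) (iota n m).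
have rf : GRing.rformula f.
  rewrite /f; elim: (iota n m) => //=; elim: (enum 'I_n) => //= j s ->.
  by rewrite rterm_term_of_mpoly.
have fE y : GRing.holds (env y) f <-> exists x, forall j, phi j x = y j.
  rewrite -GRing.foldExistsP; split=> [[e ey]|[x xy]].
    rewrite holds_foldr_And => e_eqn; exists (fun i => e`_(n + i)) => j.
    have := e_eqn j (mem_enum _ j); rewrite /= eval_term_of_mpoly GE => <-.
    by rewrite -nth_env ey // !inE mem_iota leqNgt ltn_ord.
  have e_lo (j : 'I_n) : (env y ++ env x)`_j = y j.
    by rewrite nth_cat size_env ltn_ord nth_env.
  have e_hi (i : 'I_m) : (env y ++ env x)`_(n + i) = x i.
    by rewrite nth_cat size_env ltnNge leq_addr addKn nth_env.
  (* Outside the quantified indices [n], ..., [n + m] - 1 this list agrees with [env y]; beyond them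
     both read the default 0. *)
  exists (env y ++ env x) => [i|].
    rewrite !inE mem_iota nth_cat size_env; case: (ltnP i n) => //= ni.
    by rewrite -leqNgt => nm; rewrite !nth_default ?size_env ?leq_subRL.
  apply/holds_foldr_And => j _; rewrite /= eval_term_of_mpoly e_lo -xy -GE.
  have pG : polyfun (fun z : 'I_m -> F => meval z (G j)) by exists (G j).
  by apply: (polyfun_eq_arg pG) => i; rewrite e_hi.
have wfP := @ClosedFieldQE.wf_ex_elim F.
have elimP := ClosedFieldQE.holds_ex_elim (@solve_monicpoly F).
have /andP[qf rqf] := GRing.quantifier_elim_wf wfP rf.
have [g [pg gn0 [b gE]]] := qf_generic n F0 qf rqf.
exists g; split=> //; case: b gE => gE.
  by left=> y /gE/(GRing.quantifier_elim_rformP wfP elimP _ rf)/fE.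
right=> x; apply/eqP; apply: contraT => /gE/negbT/negP[].
by apply/(GRing.quantifier_elim_rformP wfP elimP _ rf)/fE; exists x.
Qed.

(** * Surjectivity of the differential *)

Lemma dvdp_prod_XsubC_exp (F : fieldType) (a : seq F) u (p : {poly F}) :
  uniq a -> (forall x, x \in a -> ('X - x%:P) ^+ u %| p) ->
  \prod_(x <- a) ('X - x%:P) ^+ u %| p.
Proof.
elim: a => [|x a IH] /=; first by rewrite big_nil dvd1p.
case/andP=> xa ua dvd_p; rewrite big_cons Gauss_dvdp.
  rewrite dvd_p ?mem_head // IH // => y ya.
  by apply: dvd_p; rewrite inE ya orbT.
rewrite coprimep_expl // prodrXl coprimep_expr // coprimep_sym coprimep_XsubC.
by rewrite root_prod_XsubC.
Qed.

(** Expansion of L((X - a - s)^d) in powers of s by the binomial theorem. *)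
Definition binom_transform (F : fieldType) d (L : {poly F} -> F) (a : F) :
    {poly F} :=
  \poly_(l < d.+1) ((-1) ^+ l * L (('X - a%:P) ^+ (d - l)) *+ 'C(d, l)).

Lemma horner_binom_transform (F : fieldType) d (L : {scalar {poly F}}) (a s : F) :
  (binom_transform d L a).[s] = L (('X - (a + s)%:P) ^+ d).
Proof.
rewrite polyCD opprD addrA exprBn linear_sum horner_poly; apply: eq_bigr => l _.
set p := 'X - a%:P.
have -> : (-1) ^+ l * p ^+ (d - l) * s%:P ^+ l =
    ((-1) ^+ l * s ^+ l) *: p ^+ (d - l).
  by rewrite -mul_polyC polyCM !polyC_exp polyCN mulrAC.
by rewrite linearMn linearZ /= mulrnAl mulrAC.
Qed.

(* [binom_transform d L 0] is a |-> L((X - a)^d); it vanishes to order u+1 at each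
   point of [a]. *)
Lemma linear_form_eq0 (F : fieldType) d u (a : seq F) (L : {scalar {poly F}}) :
  [pchar F] =i pred0 -> uniq a -> (d < size a * u.+1)%N ->
  (forall x j, x \in a -> (j <= u)%N -> L (('X - x%:P) ^+ (d - j)) = 0) ->
  forall j, (j <= d)%N -> L 'X^j = 0.
Proof.
move=> F0 ua da Lx; set g := binom_transform d L 0.
have g_shift x : g \Po ('X + x%:P) = binom_transform d L x.
  apply: (poly_eq_values F0) => s.
  by rewrite horner_comp !horner_binom_transform hornerD hornerX hornerC
    add0r [x + s]addrC.
have dvd_g x : x \in a -> ('X - x%:P) ^+ u.+1 %| g.
  move=> xa; have -> : g = binom_transform d L x \Po ('X - x%:P).
    by rewrite -g_shift -comp_polyA comp_polyD comp_polyX comp_polyC subrK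
      comp_polyXr.
  rewrite /binom_transform poly_def rmorph_sum /=.
  elim/big_ind: _ => [|p q|l _]; [exact: dvdp0 | exact: dvdp_add |].
  (* Coefficients of index l <= u vanish by [Lx]; the remaining terms contain (X - x)^(u+1). *)
  rewrite comp_polyZ comp_Xn_poly; case: (leqP l u) => [lu|ul].
    by rewrite Lx // mulr0 mul0rn scale0r dvdp0.
  by rewrite -mul_polyC dvdp_mull // dvdp_exp2l.
(* The product of the (X - x)^(u+1) has degree [size a * u.+1] > d, while [g] has degree at most
   d. *)
have g0 : g = 0.
  apply/eqP/negPn/negP => gn0.
  have := leq_trans (dvdp_leq gn0 (dvdp_prod_XsubC_exp ua dvd_g)) (size_poly _ _).
  by rewrite prodrXl -[d.+1]add1n -leq_subLR subn1 size_exp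
    size_prod_XsubC leqNgt da.
move=> j jd.
(* Up to sign this coefficient is L(X^j) times a binomial coefficient, which is nonzero in
   characteristic zero. *)
have : g`_(d - j) = 0 by rewrite g0 coef0.
rewrite coef_poly ltnS leq_subr subKn // subr0 => /eqP.
rewrite -mulr_natr !mulf_eq0 expf_eq0 oppr_eq0 oner_eq0 andbF /=.
by rewrite ((pcharf0P _).1 F0) -leqn0 leqNgt bin_gt0 leq_subr orbF => /eqP.
Qed.

(** The linear form taking X^i to c_i for i < n and to 0 for larger i, since [poly_rV] truncates. *)
Definition coef_form (F : fieldType) n (c : 'cV[F]_n) (p : {poly F}) : F :=
  (poly_rV p *m c) 0 0.

Lemma coef_form_is_scalar (F : fieldType) n (c : 'cV[F]_n) : scalar (coef_form c).
Proof. by move=> t p q; rewrite /coef_form linearP /= mulmxDl -scalemxAl !mxE. Qed.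

HB.instance Definition _ (F : fieldType) n (c : 'cV[F]_n) :=
  GRing.isLinear.Build F {poly F} F *%R (coef_form c) (coef_form_is_scalar c).

Lemma coef_form_Xn (F : fieldType) n (c : 'cV[F]_n) (i : 'I_n) :
  coef_form c 'X^i = c i 0.
Proof.
rewrite /coef_form mxE (bigD1 i) //= mxE coefXn eqxx mul1r big1 ?addr0 // => j ji.
by rewrite mxE coefXn val_eqE (negPf ji) mul0r.
Qed.

(** Multiplication by [q] on polynomials of size at most [m], in monomial bases, truncated to [n]
    coefficients. *)
Definition shift_mx (F : fieldType) m n (q : {poly F}) : 'M[F]_(m, n) :=
  \matrix_(k < m) poly_rV (q * 'X^k).

Lemma mul_shift_mx (F : fieldType) m n (q : {poly F}) (w : 'rV[F]_m) :
  w *m shift_mx m n q = poly_rV (q * rVpoly w).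
Proof.
rewrite mulmx_sum_row /rVpoly poly_def mulr_sumr linear_sum; apply: eq_bigr => k _.
by rewrite rowK valK -scalerAr linearZ.
Qed.

(** Duality: each column of the cokernel matrix of the span is a linear form killing all products (X
    - a_i)^(d-u) z, hence zero by [linear_form_eq0]. *)
Lemma span_XsubC_exp (F : fieldType) N (a : 'I_N -> F) d u (p : {poly F}) :
  [pchar F] =i pred0 -> injective a -> (u <= d)%N -> (d < N * u.+1)%N ->
  (size p <= d.+1)%N ->
  exists z : 'I_N -> {poly F}, (forall i, size (z i) <= u.+1)%N /\
    p = \sum_i ('X - (a i)%:P) ^+ (d - u) * z i.
Proof.
move=> F0 a_inj ud dN size_p; pose q i := ('X - (a i)%:P) ^+ (d - u).
have size_q i (r : {poly F}) : (size r <= u.+1)%N -> (size (q i * r)%R <= d.+1)%N.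
  move=> sr; rewrite (leq_trans (size_polyMleq _ _)) // size_exp_XsubC /=.
  by rewrite (leq_trans (leq_add (leqnn _) sr)) // addnS subnK.
pose V i : 'M[F]_(u.+1, d.+1) := shift_mx _ _ (q i).
pose W := (\sum_i <<V i>>)%MS.
suff fullW : row_full W.
  have /sub_sumsmxP[w wE] := submx_full (poly_rV p) fullW.
  have zE i : exists z : 'rV_u.+1, w i *m <<V i>>%MS = z *m V i.
    by apply/submxP; rewrite (submx_trans (submxMl _ _)) // genmxE.
  have [z {}zE] := fin_all_exists zE.
  exists (fun i => rVpoly (z i)); split=> [i|]; first exact: size_poly.
  rewrite -[LHS](poly_rV_K size_p) wE linear_sum; apply: eq_bigr => i _.
  by rewrite zE mul_shift_mx /= poly_rV_K // size_q // size_poly.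
rewrite -cokermx_eq0; apply/eqP/matrixP => i j; rewrite [RHS]mxE.
pose c := col j (cokermx W).
have L0 l (r : {poly F}) : (size r <= u.+1)%N -> coef_form c (q l * r) = 0.
  move=> sr; rewrite /coef_form -(poly_rV_K sr) -mul_shift_mx -mulmxA.
  suff -> : V l *m c = 0 by rewrite mulmx0 mxE.
  rewrite /c colE mulmxA; suff /eqP-> : V l *m cokermx W == 0 by rewrite mul0mx.
  by rewrite -submxE (sumsmx_sup l) // genmxE.
have -> : cokermx W i j = coef_form c 'X^i by rewrite coef_form_Xn [RHS]mxE.
apply: (@linear_form_eq0 _ d u [seq a l | l <- enum 'I_N]) => //.
- by rewrite map_inj_uniq ?enum_uniq.
- by rewrite size_map size_enum_ord.
- move=> x k /mapP[l _ ->] ku.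
  (* (X - a_l)^(d-k) is [q l] times a polynomial of degree u - k <= u, hence killed. *)
  have -> : (d - k = (d - u) + (u - k))%N by rewrite addnBA // subnK.
  by rewrite exprD; apply: (L0 l); rewrite size_exp_XsubC ltnS leq_subr.
- by rewrite -ltnS.
Qed.

(** * Sums of powers *)

Lemma coef_binform (R : nzRingType) d (c : 'I_d.+1 -> R) (j : 'I_d.+1) :
  (binform c)`_j = c j.
Proof.
rewrite coef_sum (bigD1 j) //= coefZ coefXn eqxx mulr1 big1 ?addr0 // => i ij.
by rewrite coefZ coefXn val_eqE eq_sym (negPf ij) mulr0.
Qed.

Lemma size_binform (R : nzRingType) d (c : 'I_d.+1 -> R) :
  (size (binform c) <= d.+1)%N.
Proof.
rewrite (leq_trans (size_sum _ _ _)) //; apply/bigmax_leqP => i _.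
by rewrite (leq_trans (size_scale_leq _ _)) // size_polyXn.
Qed.

Lemma binform_coef (R : nzRingType) d (p : {poly R}) :
  (size p <= d.+1)%N -> binform (fun j : 'I_d.+1 => p`_j) = p.
Proof.
move=> sp; apply/polyP => i; case: (ltnP i d.+1) => [lt_id|le_di].
  by rewrite (coef_binform _ (Ordinal lt_id)).
by rewrite !nth_default // (leq_trans _ le_di) ?size_binform.
Qed.

Lemma size_exp_leq (R : idomainType) (p : {poly R}) u v :
  (size p <= u.+1)%N -> (size (p ^+ v) <= (u * v).+1)%N.
Proof.
move=> sp; rewrite (leq_trans (leqSpred _)) // ltnS size_exp leq_mul2r.
by rewrite -subn1 leq_subLR add1n sp orbT.
Qed.

(** The [N] forms are packed into one coefficient vector, so that their power sum is a polynomial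
    map of a single tuple. *)
Definition coef_block (R : nzRingType) N u (x : 'I_(N * u.+1) -> R)
    (i : 'I_N) : {poly R} :=
  binform (fun k : 'I_u.+1 => x (mxvec_index i k)).

Lemma coef_block_surj (R : nzRingType) N u (f : 'I_N -> {poly R}) :
  (forall i, size (f i) <= u.+1)%N ->
  exists x : 'I_(N * u.+1) -> R, forall i, coef_block x i = f i.
Proof.
move=> sf; exists (mxvec (\matrix_(i < N, k < u.+1) (f i)`_k) 0) => i.
rewrite -[RHS](binform_coef (sf i)); apply: eq_bigr => k _.
by rewrite mxvecE mxE.
Qed.

Lemma polyfun_power_sum (R : nzRingType) N u v :
  polyfun_coefs (fun x : 'I_(N * u.+1) -> R => \sum_i coef_block x i ^+ v).
Proof.
apply: polyfun_coefs_sum => i; apply/polyfun_coefsXn/polyfun_coefs_sum => k.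
exact/polyfun_coefsZ/polyfunX.
Qed.

(** The binomial theorem with one factor t taken out; w(0) is the derivative (v + 1) f^v z,
    coefficient by coefficient. *)
Lemma power_curve (R : comNzRingType) v (f z : {poly R}) :
  exists w : nat -> {poly R},
    (forall j, (w j).[0] = (f ^+ v * z *+ v.+1)`_j) /\
    forall t j, ((f + t *: z) ^+ v.+1)`_j = (f ^+ v.+1)`_j + t * (w j).[t].
Proof.
exists (fun j =>
  \poly_(l < v.+1) ((f ^+ (v - l) * z ^+ l.+1)`_j *+ 'C(v.+1, l.+1))).
split=> [j|t j].
  rewrite horner_coef0 coef_poly /= subn0 expr1 bin1 coefMn //.
rewrite exprDn big_ord_recl coefD /= subn0 expr0 mulr1 mulr1n; congr (_ + _).
rewrite horner_poly mulr_sumr coef_sum; apply: eq_bigr => l _.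
rewrite coefMn /bump /= add1n subSS exprZn -scalerAr coefZ.
by rewrite mulrnAl mulrnAr exprS -mulrA [t ^+ l * _]mulrC.
Qed.

(** Starting at f_i = (X - a_i)^u, velocities z_i are chosen by [span_XsubC_exp] so that the power
    sum has the prescribed derivative [w0]; dividing by v + 1 beforehand cancels the factor from the
    power rule. *)
Lemma power_sum_curves (F : fieldType) N (a : 'I_N -> F) u v :
  [pchar F] =i pred0 -> injective a -> (u * v.+1 < N * u.+1)%N ->
  forall w0 : 'I_(u * v.+1).+1 -> F,
  exists (z : 'I_N -> {poly F}) (w : 'I_(u * v.+1).+1 -> {poly F}),
  [/\ forall i, (size (z i) <= u.+1)%N, forall j, (w j).[0] = w0 j &
    forall t (j : 'I_(u * v.+1).+1),
      (\sum_i (('X - (a i)%:P) ^+ u + t *: z i) ^+ v.+1)`_j =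
      (\sum_i (('X - (a i)%:P) ^+ u) ^+ v.+1)`_j + t * (w j).[t]].
Proof.
move=> F0 a_inj lt_N w0.
have v1 : v.+1%:R != 0 :> F by rewrite ((pcharf0P _).1 F0).
have [z [sz zE]] := span_XsubC_exp F0 a_inj (leq_pmulr u (ltn0Sn v)) lt_N
  (size_binform (fun j => v.+1%:R^-1 * w0 j)).
have [w wE] := fin_all_exists
  (fun i => power_curve v (('X - (a i)%:P) ^+ u) (z i)).
exists z, (fun j => \sum_i w i j); split=> // [j|t j].
  rewrite horner_sum; under eq_bigr do rewrite (wE _).1 coefMn.
  rewrite sumrMnl.
  have -> : \sum_i (('X - (a i)%:P) ^+ u ^+ v * z i)`_j = v.+1%:R^-1 * w0 j.
    rewrite -(coef_binform (fun j => v.+1%:R^-1 * w0 j)) zE coef_sum.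
    apply: eq_bigr => i _; by congr ((_ * _ : {poly F})`_ _); rewrite -exprM mulnS addKn.
  by rewrite -[LHS]mulr_natl mulVKf.
rewrite horner_sum mulr_sumr !coef_sum -big_split; apply: eq_bigr => i _.
exact: (wE _).2.
Qed.

Theorem theorem1p8 (F : closedFieldType) (hF : [pchar F] =i pred0)
  (u v : nat) (hu : (1 <= u)%N) (hv : (1 <= v)%N) :
  general (fun c : 'I_(u * v).+1 -> F =>
    exists fs : 'I_((u * v + u).+1 %/ u.+1) -> {poly F},
      (forall i, is_binform_deg u (fs i)) /\
      binform c = \sum_(i < (u * v + u).+1 %/ u.+1) (fs i) ^+ v).
Proof.
case: v hv => // v _; set d := (u * v.+1)%N; set N := (_ %/ _)%N.
(* [N] is the ceiling of (d + 1) / (u + 1), so N (u + 1) >= d + 1. *)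
have lt_dN : (d < N * u.+1)%N.
  have := ltn_ceil (d + u).+1 (ltn0Sn u).
  by rewrite -/N mulSn -addnS addnC ltn_add2l.
pose S (x : 'I_(N * u.+1) -> F) := \sum_i coef_block x i ^+ v.+1.
pose phi (j : 'I_d.+1) x := (S x)`_j.
have pphi j : polyfun (phi j) by apply: polyfun_power_sum.
have [g [pg gn0 [g_image|g_phi]]] := polyfun_image_generic hF pphi.
  have [G GE] := pg.
  exists (fun y => g y != 0); split=> // [|y /g_image[x xE]].
    exists (fun h => h = G) => y; rewrite -GE; split=> [gy|[_ ->]] //; by exists G.
  exists (coef_block x); split=> [i|]; first exact: size_binform.
  apply/polyP => k; case: (ltnP k d.+1) => [lt_k|le_k].
    by rewrite (coef_binform _ (Ordinal lt_k)) -xE.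
  rewrite !nth_default // (leq_trans _ le_k) ?size_binform //.
  rewrite (leq_trans (size_sum _ _ _)) //; apply/bigmax_leqP => i _.
  exact/size_exp_leq/size_binform.
(* Here [g] vanishes on the image. Curves through q, the power sum of the (X - a_i)^u, force [g] to
   vanish everywhere, a contradiction. *)
pose a (i : 'I_N) : F := i%:R.
have a_inj : injective a by move=> i j /(natr_inj_pchar0 hF)/val_inj.
have [y gy] := gn0; case/negP: gy; apply/eqP.
pose q (j : 'I_d.+1) := (\sum_i (('X - (a i)%:P) ^+ u) ^+ v.+1)`_j.
apply: (polyfun_curves_eq0 (q := q) hF pg) => w0.
have [z [w [sz w0E wE]]] := power_sum_curves hF a_inj lt_dN w0.
exists w; split=> // t.
(* For each t the curve point is the power sum of the forms (X - a_i)^u + t z_i, so it lies in the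
   image. *)
have [|x xE] := @coef_block_surj _ N u
  (fun i => ('X - (a i)%:P) ^+ u + t *: z i).
  move=> i; rewrite (leq_trans (size_polyD _ _)) // geq_max size_exp_XsubC leqnn.
  exact: leq_trans (size_scale_leq _ _) (sz i).
rewrite -(g_phi x); apply: polyfun_eq_arg pg _ => j.
by rewrite /phi /S; under eq_bigr do rewrite xE; rewrite wE.
Qed.
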